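(* There is a constant $c$ with $0<c\le 7$ such that the following holds. For every constant $K>0$ there is a constant $C_K$ such that every undirected unweighted graph $G=(V,E)$ with $n$ vertices and at most $Kn$ edges admits a hub labeling $\{S_v\}$ with $$\frac{1}{n}\sum_{v\in V}|S_v|\le C_K\cdot\frac{n}{\mathsf{RS}(n)^{1/c}}.$$
   Context: A hub labeling of an undirected graph $G=(V,E)$ is a family of sets $S_v\subseteq V$, $v\in V$, such that for every pair $u,v\in V$ at finite distance there is $w\in S_u\cap S_v$ with $\mathrm{dist}(u,w)+\mathrm{dist}(w,v)=\mathrm{dist}(u,v)$. A matching $M\subseteq E(G)$ is an induced matching if there is $V'\subseteq V(G)$ such that $M$ is exactly the edge set of the subgraph of $G$ induced by $V'$. A Ruzsa–Szemerédi graph is an undirected unweighted graph on $n$ vertices whose edge set can be partitioned into at most $n$ induced matchings. $\mathsf{RS}(n)$ is the largest value such that every Ruzsa–Szemerédi graph on $n$ vertices has at most $n^2/\mathsf{RS}(n)$ edges. *)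

(* Defs.v *)
From mathcomp Require Import all_boot.
From Stdlib Require Import Reals.

Set Implicit Arguments.
Unset Strict Implicit.
Unset Printing Implicit Defensive.

Section Graphs.
Variable T : finType.
Implicit Types (e : rel T).

Definition simple_graph e : bool :=
  [forall x, ~~ e x x] && [forall x, forall y, e x y == e y x].

Definition edges e : {set {set T}} :=
  [set [set x; y] | x in T, y in T & e x y].

Definition walk e (u v : T) (k : nat) : Prop :=
  exists p : seq T, [&& path e u p, last u p == v & size p == k].

(* dist(u,v) = d  (in particular u and v are at finite distance) *)
Definition is_dist e (u v : T) (d : nat) : Prop :=
  walk e u v d /\ forall k, walk e u v k -> d <= k.

Definition hub_labeling e (S : T -> {set T}) : Prop :=
  forall u v d, is_dist e u v d ->
    exists w, [/\ w \in S u, w \in S v &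
      exists d1 d2, [/\ is_dist e u w d1, is_dist e w v d2 & d1 + d2 = d]].

Definition matching (M : {set {set T}}) : bool :=
  [forall s1 in M, forall s2 in M, (s1 != s2) ==> [disjoint s1 & s2]].

Definition induced_matching e (M : {set {set T}}) : bool :=
  (M \subset edges e) && matching M &&
  [exists V' : {set T}, M == [set s in edges e | s \subset V']].

Definition RS_graph e : bool :=
  simple_graph e &&
  [exists P : {set {set {set T}}},
     [&& partition P (edges e), #|P| <= #|T| &
         [forall M in P, induced_matching e M]]].
End Graphs.

Definition maxRS (n : nat) : nat :=
  \max_(f : {ffun 'I_n -> {ffun 'I_n -> bool}} | RS_graph (fun x y => f x y))
     #|edges (fun x y => f x y)|.

(* RS(n) = n^2 / maxRS(n); the max with 1 only matters for n <= 1,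
   where no RS graph has an edge (RS(n) would be +infinity). *)
Definition RS (n : nat) : R := (INR (n * n) / INR (maxn 1 (maxRS n)))%R.

(* Main.v *)
Require Import Defs.
From mathcomp Require Import all_boot zify.
From Stdlib Require Import Reals Lra.
(* Reals rebinds [^] on nat to Nat.pow; this restores expn. *)
Import ssrnat.

Set Implicit Arguments.
Unset Strict Implicit.
Unset Printing Implicit Defensive.

(** Take t with t^21 about RS(n) and discard three kinds of hard pairs at a cost
of O(n / t^3) hubs per vertex: vertices of degree at least t^3 become global
hubs; a greedily chosen set of O(n / t^3) global hubs meets all but n^2 / t^3 of
the pairs (u,v) having at least t^4 vertices on their shortest paths; and for a
suitable colouring with t^7 colours, all but n^2 / t^3 of the remaining pairs are
such that every vertex of a fixed geodesic is the only one of its colour among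
the possible hubs at its distance from u.

For a vertex x and distances a, b < t^4, let E_x be the set of remaining pairs
(u,v) whose fixed geodesic visits x at distance a from u and b from v.  Fix a
colour and a, b, and take a maximal matching M_x in each E_x with x of that
colour.  If (u,v), (u',v') are in M_x and (u,v') is in M_y then x is also a
possible hub for (u,v') at distance a from u, so x = y: the M_x are induced
matchings of their union, and sum |M_x| = O(n^2 / RS(n)).  Store x at the
endpoints of M_x.  For a remaining pair, every vertex of its geodesic is then
stored at u or at v, so some edge of the geodesic has its ends stored at u and v
respectively, unless one of u, v is stored at the other; adding the neighbours
of the stored vertices yields a common hub. *)

(** * Extreme values against the mean *)

Lemma exists_ge_mean (A : finType) (a0 : A) (f : A -> nat) :
  exists a, \sum_b f b <= #|A| * f a.
Proof.
case: (@arg_maxnP A a0 xpredT f isT) => a _ amax; exists a.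
by rewrite -sum_nat_const; apply: leq_sum => b _; apply: amax.
Qed.

Lemma exists_le_mean (A : finType) (a0 : A) (f : A -> nat) :
  exists a, #|A| * f a <= \sum_b f b.
Proof.
case: (@arg_minnP A a0 xpredT f isT) => a _ amin; exists a.
by rewrite -sum_nat_const; apply: leq_sum => b _; apply: amin.
Qed.

(** * Distances, fixed geodesics and possible hubs *)

Section Distance.
Variables (T : finType) (e : rel T).

Definition walkb (u v : T) (k : nat) : bool :=
  [exists p : k.-tuple T, path e u p && (last u p == v)].

Lemma walkP u v k : reflect (walk e u v k) (walkb u v k).
Proof.
apply: (iffP existsP) => [[p /andP[pp lp]]|[p /and3P[pp lp sp]]].
  by exists p; rewrite pp lp size_tuple eqxx.
by exists (Tuple sp); rewrite /= pp lp.
Qed.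

Lemma walk_cat u w v j k :
  walk e u w j -> walk e w v k -> walk e u v (j + k).
Proof.
case=> p /and3P[pp /eqP lp /eqP sp] [r /and3P[pr /eqP lr /eqP sr]].
by exists (p ++ r); rewrite cat_path last_cat size_cat lp pp pr lr sp sr !eqxx.
Qed.

Lemma walk_connect u v k : walk e u v k -> connect e u v.
Proof. by case=> p /and3P[pp /eqP <- _]; apply/connectP; exists p. Qed.

(** A shortest walk repeats no vertex, so lengths below [#|T|] suffice; the value is [#|T|] when
    there is no walk. *)
Definition dist (u v : T) : nat := find (walkb u v) (iota 0 #|T|).

Lemma connect_is_dist u v : connect e u v -> is_dist e u v (dist u v).
Proof.
case/connectP=> p pp ->; set w := last u p.
have hw : has (walkb u w) (iota 0 #|T|).
  rewrite /w; case/shortenP: pp => q pq /card_uniqP uq _.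
  apply/hasP; exists (size q); last first.
    by apply/walkP; exists q; rewrite pq !eqxx.
  by rewrite mem_iota /= add0n; have := max_card (mem (u :: q)); rewrite uq.
have ltd : dist u w < #|T| by move: hw; rewrite has_find size_iota.
split=> [|k wk].
  by apply/walkP; have := nth_find 0 hw; rewrite -/(dist u w) nth_iota.
rewrite leqNgt; apply/negP=> ltk.
have := before_find 0 (ltk : k < find _ _); rewrite nth_iota ?add0n.
  by move/walkP: wk => ->.
exact: ltn_trans ltd.
Qed.

Lemma is_dist_uniq u v d : is_dist e u v d -> d = dist u v.
Proof.
case=> wd mind; have [wd' mind'] := connect_is_dist (walk_connect wd).
by apply/eqP; rewrite eqn_leq mind // mind'.
Qed.

Lemma walk_dist_le u v k : walk e u v k -> dist u v <= k.
Proof.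
by move=> wk; case: (connect_is_dist (walk_connect wk)) => _; apply.
Qed.

Lemma dist_triangle u w v :
  connect e u w -> connect e w v -> dist u v <= dist u w + dist w v.
Proof.
move=> /connect_is_dist[w1 _] /connect_is_dist[w2 _].
exact: walk_dist_le (walk_cat w1 w2).
Qed.

(** One shortest path per ordered pair is fixed once and for all; the default branch is reached only
    when [v] is unreachable from [u]. *)
Definition geodesic (u v : T) : seq T :=
  if [pick p : (dist u v).-tuple T | path e u p && (last u p == v)] is Some p
  then p else [::].

Definition geo (u v : T) (i : nat) : T := nth u (u :: geodesic u v) i.

Lemma geodesicP u v : connect e u v ->
  [/\ path e u (geodesic u v), last u (geodesic u v) = v
    & size (geodesic u v) = dist u v].
Proof.
move=> /connect_is_dist[/walkP/existsP[p pP] _].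
rewrite /geodesic; case: pickP => [q /andP[pq /eqP lq]|/(_ p)]; last by rewrite pP.
by rewrite size_tuple.
Qed.

Lemma last_take_nth (u : T) p i : i <= size p ->
  last u (take i p) = nth u (u :: p) i.
Proof.
elim: p u i => [|x p IH] u [|i] //= si; rewrite IH //.
by case: i si => //= i si; apply: set_nth_default.
Qed.

(** Cutting the geodesic at [i] bounds both distances from above; the triangle inequality turns the
    bounds into equalities. *)
Lemma geoP u v i : connect e u v -> i <= dist u v ->
  [/\ connect e u (geo u v i), connect e (geo u v i) v,
      dist u (geo u v i) = i & dist (geo u v i) v = dist u v - i].
Proof.
move=> uv le_i; have [pp lp sp] := geodesicP uv.
have w1 : walk e u (geo u v i) i.
  exists (take i (geodesic u v)); rewrite take_path //= last_take_nth ?sp //.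
  by rewrite size_takel ?sp ?eqxx.
have w2 : walk e (geo u v i) v (dist u v - i).
  exists (drop i (geodesic u v)); rewrite size_drop sp eqxx andbT.
  move: pp lp; rewrite -{1 2}(cat_take_drop i (geodesic u v)) cat_path last_cat.
  by rewrite last_take_nth ?sp // => /andP[_ ->] ->; rewrite eqxx.
have c1 := walk_connect w1; have c2 := walk_connect w2.
have := walk_dist_le w1; have := walk_dist_le w2.
by have := dist_triangle c1 c2; split=> //; lia.
Qed.

Lemma geo0 u v : geo u v 0 = u.
Proof. by []. Qed.

Lemma geo_dist u v : connect e u v -> geo u v (dist u v) = v.
Proof.
by case/geodesicP=> _ lp sp; rewrite -[RHS]lp /geo -sp -last_take_nth // take_size.
Qed.

Lemma geo_edge u v i : connect e u v -> i < dist u v ->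
  e (geo u v i) (geo u v i.+1).
Proof.
move=> /geodesicP[pp _ <-] lt_i.
by move/(pathP u): pp; apply.
Qed.

Definition hubs (u v : T) : {set T} :=
  [set w | [&& connect e u w, connect e w v & dist u w + dist w v == dist u v]].

Lemma geo_hubs u v i : connect e u v -> i <= dist u v -> geo u v i \in hubs u v.
Proof.
by move=> uv le_i; case: (geoP uv le_i) => c1 c2 d1 d2; rewrite inE c1 c2 d1 d2 subnKC /=.
Qed.

(** The geodesic vertices are hubs told apart by their distance from [u]. Pairs with few hubs are
    therefore close. *)
Lemma dist_lt_hubs u v : connect e u v -> dist u v < #|hubs u v|.
Proof.
move=> uv.
have inj : injective (fun i : 'I_(dist u v).+1 => geo u v i).
  move=> i j /= eq_ij; apply: val_inj => /=.
  have [_ _ di _] := geoP uv (ltn_ord i : i <= dist u v).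
  have [_ _ dj _] := geoP uv (ltn_ord j : j <= dist u v).
  by rewrite -[LHS]di eq_ij.
rewrite -[X in X <= _]card_ord -(card_codom inj); apply: subset_leq_card.
by apply/subsetP=> w /codomP[i ->]; apply: geo_hubs uv (ltn_ord i).
Qed.

Lemma hub_labelingP (S : T -> {set T}) :
  (forall u v, connect e u v -> exists w, [/\ w \in S u, w \in S v & w \in hubs u v]) ->
  hub_labeling e S.
Proof.
move=> HS u v d duv; have uv : connect e u v by case: duv => /walk_connect.
case: (HS u v uv) => w [wu wv]; rewrite inE => /and3P[c1 c2 /eqP dd].
exists w; split=> //; exists (dist u w), (dist w v).
by rewrite dd -(is_dist_uniq duv); split=> //; apply: connect_is_dist.
Qed.

Lemma sum_deg_le :
  simple_graph e -> \sum_x #|[set y | e x y]| <= 2 * #|edges e|.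
Proof.
case/andP=> /forallP irr _.
pose D := [set p : T * T | e p.1 p.2].
have -> : \sum_x #|[set y | e x y]| = #|D|.
  rewrite -sum1_card (eq_bigl (fun p : T * T => xpredT p.1 && e p.1 p.2)).
    rewrite -(pair_big_dep xpredT (fun x y => e x y) (fun _ _ => 1)) /=.
    by apply: eq_bigr => x _; rewrite -sum1_card; apply: eq_bigl => y; rewrite inE.
  by move=> p; rewrite inE.
(* An ordered adjacent pair is recovered from its edge and one bit telling which end has the smaller
   rank. *)
pose f (p : T * T) := ([set p.1; p.2], enum_rank p.1 < enum_rank p.2).
have inj : {in D &, injective f}.
  move=> [x y] [x' y']; rewrite !inE /= => exy exy' [eqs eqr].
  have nxy : x != y by apply: contraTneq exy => ->; apply: irr.
  have nr : enum_rank x != enum_rank y :> nat by rewrite -(inj_eq enum_rank_inj) in nxy.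
  have: x' \in [set x; y] by rewrite eqs set21.
  have: y' \in [set x; y] by rewrite eqs set22.
  have: x' != y' by apply: contraTneq exy' => ->; apply: irr.
  rewrite !inE => nxy' /orP[]/eqP ey /orP[]/eqP ex; move: nxy' eqr; rewrite ex ey ?eqxx // => _.
  by move: nr => /[swap]; case: ltngtP.
rewrite -(card_in_imset inj).
have: f @: D \subset setX (edges e) [set: bool].
  apply/subsetP=> s /imsetP[[x y]]; rewrite inE /= => exy ->.
  by rewrite !inE andbT; apply/imset2P; exists x y; rewrite ?inE.
by move/subset_leq_card; rewrite cardsX cardsT card_bool mulnC.
Qed.
End Distance.

(** * Hitting sets and colourings by averaging *)

Section Averaging.
Variables T I : finType.
Implicit Types (H : I -> {set T}) (P : {set I}) (X : {set T}).

Definition unhit H P X : {set I} := [set i in P | [disjoint X & H i]].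

Lemma popular_point H P l : P != set0 -> 0 < l -> {in P, forall i, l <= #|H i|} ->
  exists x, l * #|P| <= #|T| * #|[set i in P | x \in H i]|.
Proof.
case/set0Pn=> i0 Pi0 l0 lH.
have /card_gt0P[x0 _] : 0 < #|H i0| by apply: leq_trans (lH _ Pi0).
have [x mx] := exists_ge_mean x0 (fun x => #|[set i in P | x \in H i]|).
exists x; apply: leq_trans mx.
rewrite (eq_bigr (fun x => \sum_(i in P) (x \in H i))); last first.
  by move=> y _; rewrite -big_mkcondr sum1dep_card.
rewrite exchange_big mulnC -sum_nat_const; apply: leq_sum => i Pi /=.
by rewrite -big_mkcond sum1_card lH.
Qed.

(** Each greedy point hits at least a fraction [l / #|T|] of the sets still missed. The linear bound
    kept here is weaker than exponential decay but has a purely algebraic induction. *)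
Lemma greedy_hitting H P l s : 0 < l -> {in P, forall i, l <= #|H i|} ->
  exists2 X : {set T}, #|X| <= s & (#|T| + s * l) * #|unhit H P X| <= #|T| * #|P|.
Proof.
move=> l0 lH; elim: s => [|s [X sX IH]].
  exists set0; rewrite ?cards0 // mul0n addn0 leq_mul2l; apply/orP; right.
  by apply: subset_leq_card; apply/subsetP=> i; rewrite inE => /andP[].
have [U0|U0] := eqVneq (unhit H P X) set0.
  by exists X; [exact: leqW | rewrite U0 cards0 muln0].
have lHU : {in unhit H P X, forall i, l <= #|H i|}.
  by move=> i; rewrite inE => /andP[/lH].
have [x] := popular_point U0 l0 lHU.
set Q := [set i in _ | _] => mx.
exists (x |: X); first by rewrite cardsU1; lia.
have -> : unhit H P (x |: X) = unhit H P X :\: Q.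
  apply/setP=> i; rewrite !inE -setI_eq0 setIUl setU_eq0 !setI_eq0 disjoints1.
  by case: (i \in P) => //=; case: [disjoint _ & _]; rewrite ?andbF ?andbT.
have sQ : Q \subset unhit H P X by apply/subsetP=> i; rewrite inE => /andP[].
have := cardsDS sQ; have := subset_leq_card sQ.
(* Here [d = u - q] and [l * u <= n * q]: the new term [l * d] is at most [n * q], paid for by the
   loss of [(n + s * l) * q]. *)
move: #|_ :\: _| #|Q| #|unhit _ _ _| #|P| #|T| IH mx => d q u p n; nia.
Qed.

(* k rounds give the decay (n / (s l))^k; k = 3 is what the exponent 7 needs. *)
Lemma iterated_hitting H P l s k : 0 < l -> {in P, forall i, l <= #|H i|} ->
  exists2 X : {set T}, #|X| <= k * s & (s * l) ^ k * #|unhit H P X| <= #|T| ^ k * #|P|.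
Proof.
move=> l0 lH; elim: k => [|k [X sX IH]].
  exists set0; rewrite ?cards0 // !mul1n.
  by apply: subset_leq_card; apply/subsetP=> i; rewrite inE => /andP[].
have lHU : {in unhit H P X, forall i, l <= #|H i|}.
  by move=> i; rewrite inE => /andP[/lH].
have [Y sY hY] := greedy_hitting s l0 lHU.
exists (X :|: Y); first by rewrite (leq_trans (leq_card_setU _ _)) // mulSn addnC leq_add.
have -> : unhit H P (X :|: Y) = unhit H (unhit H P X) Y.
  by apply/setP=> i; rewrite !inE -andbA -!setI_eq0 setIUl setU_eq0.
have {}hY : s * l * #|unhit H (unhit H P X) Y| <= #|T| * #|unhit H P X|.
  by apply: leq_trans hY; rewrite leq_mul2r leq_addl orbT.
rewrite !expnS (mulnC (s * l)) -!mulnA.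
apply: leq_trans (_ : (s * l) ^ k * (#|T| * #|unhit H P X|) <= _).
  by rewrite leq_mul2l mulnA hY orbT.
by rewrite mulnCA leq_mul2l IH orbT.
Qed.

(** When [f x = f y], recolouring [x] in any of [q] ways loses nothing: its old colour can be read
    off at [y]. *)
Lemma card_collision q (x y : T) : x != y ->
  q * #|[set f : {ffun T -> 'I_q} | f x == f y]| <= #|{ffun T -> 'I_q}|.
Proof.
move=> nxy; rewrite -[X in X * _]card_ord -cardsT -cardsX.
pose h (p : 'I_q * {ffun T -> 'I_q}) :=
  [ffun z => if z == x then p.1 else p.2 z].
have inj : {in setX [set: 'I_q] [set f : {ffun T -> 'I_q} | f x == f y] &, injective h}.
  move=> [c f] [c' f']; rewrite !inE /= => /eqP fxy /eqP fxy' /ffunP eqh.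
  have eqf z : z != x -> f z = f' z.
    by move=> /negPf zx; have := eqh z; rewrite !ffunE /= zx.
  congr pair; first by have := eqh x; rewrite !ffunE /= eqxx.
  apply/ffunP=> z; have [->|] := eqVneq z x; last exact: eqf.
  by rewrite fxy fxy' eqf // eq_sym.
by rewrite -(card_in_imset inj) max_card.
Qed.

(** In use, [i] is a pair of vertices, [H i] its possible hubs, and [g i y] the vertex of the fixed
    geodesic at the same distance from the first end as [y]. *)
Definition clash q H (g : I -> T -> T) (f : {ffun T -> 'I_q}) (i : I) : bool :=
  [exists y in H i, (y != g i y) && (f y == f (g i y))].

(** First moment: in a random colouring each of the at most [l] points of [H i] clashes with
    probability at most [1 / q]. *)
Lemma exists_coloring H P (g : I -> T -> T) l q : 0 < q ->
  {in P, forall i, #|H i| <= l} ->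
  exists f : {ffun T -> 'I_q}, q * #|[set i in P | clash H g f i]| <= #|P| * l.
Proof.
move=> q0 lH; pose f0 : {ffun T -> 'I_q} := [ffun=> Ordinal q0].
have [f hf] := exists_le_mean f0 (fun f => q * #|[set i in P | clash H g f i]|).
exists f; rewrite -(@leq_pmul2l #|{ffun T -> 'I_q}|); last by apply/card_gt0P; exists f0.
apply: leq_trans hf _; rewrite -big_distrr /=.
apply: leq_trans (_ : q * \sum_(f : {ffun T -> 'I_q}) \sum_(i in P) \sum_(y in H i | y != g i y)
   (f y == f (g i y)) <= _).
  rewrite leq_mul2l; apply/orP; right; apply: leq_sum => h _.
  rewrite -sum1dep_card big_mkcondr; apply: leq_sum => i _ /=.
  case: ifP => // /existsP[y /and3P[Hy ny cy]].
  by rewrite (bigD1 y) ?Hy //= cy.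
rewrite exchange_big big_distrr mulnCA /= -sum_nat_const; apply: leq_sum => i Pi.
rewrite exchange_big big_distrr /=.
apply: leq_trans (_ : \sum_(y in H i) #|{ffun T -> 'I_q}| <= _); last first.
  by rewrite sum_nat_const mulnC leq_mul2l lH // orbT.
rewrite big_mkcondr; apply: leq_sum => y _ /=; case: ifP => // ny.
by rewrite -big_mkcond sum1dep_card card_collision.
Qed.
End Averaging.

(** * Directed cuts *)

(** Forcing [u] into a set and [v] out of it can be undone by remembering two bits. *)
Lemma card_directed_cut (T : finType) (u v : T) : u != v ->
  #|{set T}| <= 4 * #|[set A : {set T} | (u \in A) && (v \notin A)]|.
Proof.
move=> nuv; set D := [set A | _].
pose h (A : {set T}) := ((u |: A) :\ v, (u \in A, v \in A)).
have inj : injective h.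
  move=> A B [/setP eqAB equ eqv]; apply/setP=> z; have := eqAB z.
  rewrite !inE; have [->|_] := eqVneq z v; first by rewrite eqv.
  by have [->|_] := eqVneq z u; rewrite ?equ.
rewrite -(card_codom inj).
have: codom h \subset setX D [set: bool * bool].
  apply/subsetP=> _ /codomP[A ->]; rewrite !inE eqxx nuv /=.
  by rewrite eqxx.
by move/subset_leq_card; rewrite cardsX cardsT card_prod card_bool mulnC.
Qed.

Lemma exists_directed_cut (T J : finType) (E : {set J}) (s t : J -> T) :
  {in E, forall j, s j != t j} ->
  exists A : {set T}, #|E| <= 4 * #|[set j in E | (s j \in A) && (t j \notin A)]|.
Proof.
move=> irr.
have [A hA] := exists_ge_mean (set0 : {set T})
  (fun A => 4 * #|[set j in E | (s j \in A) && (t j \notin A)]|).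
exists A; rewrite -(@leq_pmul2l #|{set T}|); last by apply/card_gt0P; exists set0.
apply: leq_trans hA; rewrite -big_distrr /=.
rewrite (eq_bigr (fun A : {set T} => \sum_(j in E) ((s j \in A) && (t j \notin A)))); last first.
  by move=> B _; rewrite -big_mkcondr sum1dep_card.
rewrite exchange_big big_distrr mulnC -sum_nat_const /=; apply: leq_sum => j Ej.
by rewrite -big_mkcond sum1dep_card card_directed_cut // irr.
Qed.

(** * Families of induced matchings indexed by vertices *)

Section InducedMatchings.
Variable T : finType.
Implicit Types (A : {set T}) (p : T * T) (M : T -> {set T * T}).

Definition uedge p : {set T} := [set p.1; p.2].

Definition cut A : {set T * T} := [set p | (p.1 \in A) && (p.2 \notin A)].

Lemma cut_endpoints A p q : p \in cut A -> q \in cut A ->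
  p.1 \in uedge q -> p.2 \in uedge q -> p = q.
Proof.
case: p q => [u v] [u' v']; rewrite !inE /= => /andP[uA vA] /andP[uA' vA'].
have nuv : u != v' by apply: contraNneq vA' => <-.
have nvu : v != u' by apply: contraNneq vA => ->.
by rewrite (negPf nuv) (negPf nvu) orbF /= => /eqP-> /eqP->.
Qed.

Lemma uedge_cut_inj A : {in cut A &, injective uedge}.
Proof.
move=> p q pA qA epq; apply: (cut_endpoints pA qA); rewrite -epq.
  exact: set21.
exact: set22.
Qed.

(** The last hypothesis only controls pairs made of a first and a second end. Restricting to a
    directed cut costs a factor 4 and orients all edges alike, so no other edges can spoil the
    matchings. There is at most one matching per vertex, so the union is a Ruzsa-Szemerédi graph. *)
Lemma induced_family_card m M :
  (forall e : rel T, RS_graph e -> #|edges e| <= m) ->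
  (forall x p, p \in M x -> p.1 != p.2) ->
  (forall x, {in M x &, injective fst}) ->
  (forall x, {in M x &, injective snd}) ->
  (forall x y, {in M x &, forall p q, (p.1, q.2) \in M y -> x = y}) ->
  \sum_x #|M x| <= 4 * m.
Proof.
move=> hm irr inj1 inj2 ind.
pose E := [set j : T * (T * T) | j.2 \in M j.1].
have -> : \sum_x #|M x| = #|E|.
  rewrite -sum1_card (eq_bigl (fun j : T * (T * T) => xpredT j.1 && (j.2 \in M j.1))).
    rewrite -(pair_big_dep xpredT (fun x p => p \in M x) (fun _ _ => 1)) /=.
    by apply: eq_bigr => x _; rewrite sum1_card.
  by move=> p; rewrite inE.
have irrE : {in E, forall j, j.2.1 != j.2.2}.
  by move=> j; rewrite inE => /irr.
have [A hA] := exists_directed_cut irrE.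
apply: (leq_trans hA); rewrite leq_mul2l /=.
pose N x := M x :&: cut A.
have NM x p : p \in N x -> p \in M x by rewrite inE => /andP[].
have NA x p : p \in N x -> p \in cut A by rewrite inE => /andP[].
have uniqN x y p : p \in N x -> p \in N y -> x = y.
  by move=> px py; apply: (ind _ _ p p); rewrite -?surjective_pairing ?NM.
pose e u v := [exists x, ((u, v) \in N x) || ((v, u) \in N x)].
pose part x := uedge @: N x.
have edgesE s : s \in edges e = [exists x, s \in part x].
  apply/idP/existsP.
    case/imset2P=> u v _; rewrite inE => /existsP[x /orP[]] Nx ->; exists x.
      by apply/imsetP; exists (u, v).
    by apply/imsetP; exists (v, u); rewrite // /uedge setUC.
  case=> x /imsetP[[u v] Nx ->]; apply/imset2P; exists u v; rewrite ?inE //.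
  by apply/existsP; exists x; rewrite Nx.
apply: leq_trans (hm e _); last first.
  apply/andP; split.
    apply/andP; split.
      apply/forallP=> u; apply/existsP=> -[x]; rewrite orbb => /NA.
      by rewrite inE /= andbN.
    apply/forallP=> u; apply/forallP=> v; apply/eqP.
    by apply: eq_existsb => x; rewrite orbC.
  (* Empty parts are dropped because [partition] forbids them. *)
  apply/existsP; exists [set part x | x in T & N x != set0].
  apply/and3P; split.
  - apply/and3P; split.
    + apply/eqP/setP=> s; rewrite edgesE; apply/bigcupP/existsP.
        by case=> B /imsetP[x _ ->] sx; exists x.
      case=> x sx; exists (part x) => //; apply/imsetP; exists x => //.
      rewrite inE; apply/set0Pn; case/imsetP: sx => p px _.
      by exists p.
    + apply/trivIsetP=> B C /imsetP[x _ ->] /imsetP[y _ ->].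
      apply: contraNT; rewrite -setI_eq0 => /set0Pn[s].
      rewrite inE => /andP[/imsetP[p px ->] /imsetP[q qy epq]].
      have epq' := uedge_cut_inj (NA _ _ px) (NA _ _ qy) epq.
      by rewrite (uniqN x y p) // epq'.
    + apply/imsetP=> -[x]; rewrite inE => /set0Pn[p px] /eqP.
      by rewrite eq_sym imset_eq0 => /eqP eN; rewrite eN inE in px.
  - by apply: leq_trans (leq_imset_card _ _) (max_card _).
  apply/forallP=> B; apply/implyP=> /imsetP[x _ ->].
  apply/andP; split; first (apply/andP; split).
  - by apply/subsetP=> s sx; rewrite edgesE; apply/existsP; exists x.
  - apply/forallP=> s1; apply/implyP=> /imsetP[p px ->].
    apply/forallP=> s2; apply/implyP=> /imsetP[q qx ->]; apply/implyP.
    apply: contraNT; rewrite -setI_eq0 => /set0Pn[z].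
    rewrite !inE.
    have /[!inE] /andP[p1 p2] := NA _ _ px; have /[!inE] /andP[q1 q2] := NA _ _ qx.
    case/andP=> /orP[]/eqP -> /orP[]/eqP epq.
    + by rewrite (inj1 x p q) ?NM.
    + by rewrite epq (negPf q2) in p1.
    + by rewrite epq q1 in p2.
    + by rewrite (inj2 x p q) ?NM.
  (* The inducing set consists of the matched vertices. By the cut, an edge [r] inside it joins the
     first end of some [p] to the second end of some [q] of this matching; [ind] then places [r] in
     the same matching. *)
  apply/existsP; exists (cover (part x)); apply/eqP/setP=> s; rewrite inE edgesE.
  apply/idP/andP=> [sx|[/existsP[y /imsetP[r ry ->]] /subsetP sub]].
    split; first by apply/existsP; exists x.
    by apply: bigcup_sup.
  have /bigcupP[_ /imsetP[p px ->] r1p] := sub r.1 (set21 _ _).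
  have /bigcupP[_ /imsetP[q qx ->] r2q] := sub r.2 (set22 _ _).
  have /[!inE] /andP[r1 r2] := NA _ _ ry.
  have /[!inE] /andP[p1 p2] := NA _ _ px; have /[!inE] /andP[q1 q2] := NA _ _ qx.
  move: r1p r2q; rewrite !inE => /orP[/eqP e1|/eqP e1]; last by rewrite -e1 r1 in p2.
  case/orP=> /eqP e2; first by rewrite e2 q1 in r2.
  have eyx : x = y by apply: (ind x y p q); rewrite -?e1 -?e2 -?surjective_pairing ?NM.
  by apply: imset_f; rewrite eyx.
set C := [set j in E | _].
have CN j : j \in C -> j.2 \in N j.1 by rewrite !inE.
have injC : {in C &, injective (fun j => uedge j.2)}.
  move=> i j /CN iN /CN jN eij.
  have e2 := uedge_cut_inj (NA _ _ iN) (NA _ _ jN) eij.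
  have e1 : i.1 = j.1 by apply: (uniqN _ _ i.2); rewrite // e2.
  by rewrite (surjective_pairing i) (surjective_pairing j) e1 e2.
rewrite -(card_in_imset injC); apply: subset_leq_card.
apply/subsetP=> _ /imsetP[j /CN jN ->]; rewrite edgesE; apply/existsP; exists j.1.
exact: imset_f.
Qed.

(** First and second coordinates are never compared, so this is a matching in the bipartite double
    cover; by maximality no pair of [E] can be free of it. *)
Lemma maximal_matching (E : {set T * T}) : exists M : {set T * T},
  [/\ M \subset E, {in M &, injective fst}, {in M &, injective snd}
    & {in E, forall p, exists2 q, q \in M & q.1 = p.1 \/ q.2 = p.2}].
Proof.
pose ok (M : {set T * T}) := (M \subset E) &&
  [forall p in M, forall q in M, ((p.1 == q.1) || (p.2 == q.2)) ==> (p == q)].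
have ok0 : ok set0.
  by rewrite /ok sub0set; apply/forallP=> p; rewrite inE.
have [M /maxsetP[/andP[sM /forall_inP mM] maxM] _] := maxset_exists ok0.
have mM2 : {in M &, forall p q, p.1 = q.1 \/ p.2 = q.2 -> p = q}.
  move=> p q pM qM h; apply/eqP; move: (mM p pM) => /forall_inP/(_ q qM)/implyP; apply.
  by case: h => ->; rewrite eqxx ?orbT.
exists M; split=> //.
- by move=> p q pM qM h; apply: mM2 => //; left.
- by move=> p q pM qM h; apply: mM2 => //; right.
move=> p pE; have [/existsP[q /andP[qM /orP h]]|/existsPn hp] :=
  boolP [exists q, (q \in M) && ((q.1 == p.1) || (q.2 == p.2))].
  by exists q => //; case: h => /eqP; [left|right].
have hp' q : q \in M -> (q.1 == p.1) || (q.2 == p.2) = false.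
  by move=> qM; apply/negbTE; have := hp q; rewrite qM.
suff pM : p \in M by have := hp p; rewrite pM eqxx.
rewrite -(maxM (p |: M)) ?setU11 ?subsetUr //; apply/andP; split.
  by rewrite subUset sub1set pE sM.
apply/forall_inP=> a; rewrite in_setU1 => /orP[/eqP->|aM];
  apply/forall_inP=> b; rewrite in_setU1 => /orP[/eqP->|bM].
- by rewrite !eqxx.
- by rewrite (eq_sym p.1) (eq_sym p.2) hp'.
- by rewrite hp'.
- exact: (forall_inP (mM a aM)).
Qed.

(* F v collects the x for which v is an endpoint of a maximal matching of E x. *)
Lemma induced_family_cover m (E : T -> {set T * T}) :
  (forall e : rel T, RS_graph e -> #|edges e| <= m) ->
  (forall x p, p \in E x -> p.1 != p.2) ->
  (forall x y, {in E x &, forall p q, (p.1, q.2) \in E y -> x = y}) ->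
  exists F : T -> {set T}, \sum_v #|F v| <= 8 * m /\
    forall x p, p \in E x -> (x \in F p.1) || (x \in F p.2).
Proof.
move=> hm irr ind.
have [M MP] := fin_all_exists (fun x => maximal_matching (E x)).
have ME x p : p \in M x -> p \in E x by case: (MP x) => /subsetP s _ _ _; apply: s.
have cM : \sum_x #|M x| <= 4 * m.
  apply: induced_family_card => // [x p /ME/irr //|x|x|x y p q /ME px /ME qx /ME].
  - by case: (MP x).
  - by case: (MP x).
  - exact: ind.
exists (fun v => [set x | [exists p in M x, (p.1 == v) || (p.2 == v)]]); split; last first.
  move=> x p px; case: (MP x) => _ _ _ /(_ p px)[q qM h]; rewrite !inE.
  by apply/orP; case: h => <-; [left|right]; apply/existsP; exists q; rewrite qM eqxx ?orbT.
(* Each matched pair is counted at both ends, which doubles the factor 4. *)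
apply: leq_trans (_ : \sum_v \sum_x \sum_(p in M x) ((p.1 == v) + (p.2 == v)) <= _).
  apply: leq_sum => v _; rewrite -sum1dep_card big_mkcond; apply: leq_sum => x _ /=.
  case: ifP => // /existsP[p /andP[pM h]]; rewrite (bigD1 p) //=.
  by case/orP: h => ->; rewrite -?addnA ?addnS.
rewrite exchange_big (@leq_trans (2 * \sum_x #|M x|)) //; last by lia.
rewrite big_distrr; apply: leq_sum => x _ /=; rewrite exchange_big /= mulnC -sum_nat_const.
apply: leq_sum => p _; rewrite big_split /=.
have one (w : T) : \sum_v (w == v) = 1.
  by rewrite (bigD1 w) //= eqxx big1 // => v; rewrite eq_sym => /negPf->.
by rewrite !one.
Qed.
End InducedMatchings.

(** * The labeling for general parameters *)

Lemma card_bigcup_le (I T : finType) (P : {pred I}) (F : I -> {set T}) :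
  #|\bigcup_(i in P) F i| <= \sum_(i in P) #|F i|.
Proof.
elim/big_ind2: _ => [|a A b B hA hB|//]; first by rewrite cards0.
by rewrite (leq_trans (leq_card_setU A B)) ?leq_add.
Qed.

Section Construction.
(** [D] is the degree threshold, [l] the threshold on the number of possible hubs, [q] the number of
    colours; [k] rounds of [s] points give the hitting set; [m] bounds the edges of Ruzsa-Szemerédi
    graphs. *)
Variables (T : finType) (e : rel T) (l q D s k m : nat).
Hypothesis simple_e : simple_graph e.
Hypotheses (l_gt0 : 0 < l) (q_gt0 : 0 < q).
Hypothesis RS_le : forall e' : rel T, RS_graph e' -> #|edges e'| <= m.

Let H (p : T * T) := hubs e p.1 p.2.
Let partner (p : T * T) (y : T) := geo e p.1 p.2 (dist e p.1 y).
Let high : {set T} := [set x | D <= #|[set y | e x y]|].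
Let large : {set T * T} := [set p | l <= #|H p|].
Let small : {set T * T} := [set p | connect e p.1 p.2 && (#|H p| < l)].

Let nice (f : {ffun T -> 'I_q}) (p : T * T) :=
  [&& p.1 != p.2, p \in small, ~~ clash H partner f p & [disjoint high & H p]].

(** One induced family is used for each colour and each pair of distances, hence the factor
    [q * (l * l)]. *)
Lemma nice_cover (f : {ffun T -> 'I_q}) :
  exists F : T -> {set T}, \sum_v #|F v| <= q * (l * l) * (8 * m) /\
    forall p i, nice f p -> i <= dist e p.1 p.2 ->
      (geo e p.1 p.2 i \in F p.1) || (geo e p.1 p.2 i \in F p.2).
Proof.
pose E (j : 'I_q * ('I_l * 'I_l)) x := [set p : T * T |
  [&& nice f p, dist e p.1 p.2 == j.2.1 + j.2.2,
      x == geo e p.1 p.2 j.2.1 & f x == j.1]].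
have EP j x p : p \in E j x -> [/\ nice f p, connect e p.1 p.2 &
    [/\ dist e p.1 p.2 = j.2.1 + j.2.2, x = geo e p.1 p.2 j.2.1 & f x = j.1]].
  rewrite inE => /and4P[np /eqP dp /eqP xp /eqP fx]; split=> //.
  by case/and4P: np => _; rewrite inE => /andP[].
have cover j : exists F : T -> {set T}, \sum_v #|F v| <= 8 * m /\
    forall x p, p \in E j x -> (x \in F p.1) || (x \in F p.2).
  apply: induced_family_cover => // [x p /EP[/and4P[]] //|x y p r].
  move=> /EP[_ cp [dp xp fx]] /EP[_ cr [dr xr _]].
  move=> /EP[/= npr cpr [/= dpr yp fy]].
  have [c1 _ d1 _] := geoP cp (leq_trans (leq_addr _ _) (eq_leq (esym dp))).
  have [_ c2 _ d2] := geoP cr (leq_trans (leq_addr _ _) (eq_leq (esym dr))).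
  rewrite -xp in c1 d1; rewrite -xr in c2 d2.
  (* In the mixed pair, [x] is a hub level with the geodesic vertex [y] and of the same colour; the
     absence of a clash gives [x = y]. *)
  have hx : x \in H (p.1, r.2) by rewrite inE /= c1 c2 d1 d2 dr dpr addKn eqxx.
  case/and4P: npr => _ _ /existsPn/(_ x) + _.
  by rewrite hx /partner /= d1 -yp fx fy eqxx andbT negbK => /eqP.
have [F FP] := fin_all_exists cover.
exists (fun v => \bigcup_(j in setT) F j v); split.
  apply: leq_trans (_ : \sum_v \sum_(j in setT) #|F j v| <= _).
    by apply: leq_sum => v _; apply: card_bigcup_le.
  rewrite exchange_big /= (@leq_trans (\sum_(j in [set: 'I_q * ('I_l * 'I_l)]) 8 * m)) //.
    by apply: leq_sum => j _; case: (FP j).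
  by rewrite sum_nat_const cardsT !card_prod !card_ord.
move=> p i np le_i.
have /andP[cp lp] : connect e p.1 p.2 && (#|H p| < l).
  by case/and4P: np => _; rewrite inE.
have ltl := ltn_trans (dist_lt_hubs cp) lp.
have ltb : dist e p.1 p.2 - i < l by rewrite (leq_ltn_trans (leq_subr _ _)).
pose j := (f (geo e p.1 p.2 i), (Ordinal (leq_ltn_trans le_i ltl), Ordinal ltb)).
have pE : p \in E j (geo e p.1 p.2 i) by rewrite inE np /= subnKC ?eqxx.
case: (FP j) => _ /(_ _ _ pE)/orP[] h; apply/orP; [left|right];
  by apply/bigcupP; exists j.
Qed.

Lemma exists_hub_labeling : exists (S : T -> {set T}) (h r1 r2 : nat),
  [/\ hub_labeling e S,
      \sum_v #|S v| <= #|T| * (h + k * s + 1) + r1 + r2 + D * (q * (l * l) * (8 * m)),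
      D * h <= 2 * #|edges e|,
      (s * l) ^ k * r1 <= #|T| ^ k * (#|T| * #|T|)
    & q * r2 <= #|T| * #|T| * l].
Proof.
have [X cX hX] : exists2 X : {set T}, #|X| <= k * s &
    (s * l) ^ k * #|unhit H large X| <= #|T| ^ k * #|large|.
  by apply: iterated_hitting => // p; rewrite inE.
have [f hf] : exists f : {ffun T -> 'I_q},
    q * #|[set p in small | clash H partner f p]| <= #|small| * l.
  by apply: exists_coloring => // p; rewrite inE => /andP[_ /ltnW].
have [F [cF FP]] := nice_cover f.
set R1 := unhit _ _ _ in hX; set R2 := [set p in _ | _] in hf.
pose N x := x |: [set y | e x y].
(* An exceptional pair [(v, w)] is recorded at [v] only, since [w] lies in [S w] anyway. *)
pose S v := high :|: X :|: [set v] :|: [set w | (v, w) \in R1 :|: R2]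
  :|: \bigcup_(x in F v :\: high) N x.
have cpairs (A : {set T * T}) : #|A| <= #|T| * #|T| by rewrite -card_prod max_card.
exists S, #|high|, #|R1|, #|R2|; split.
- apply: hub_labelingP => u v uv.
  have uS w : w \in S w by rewrite !inE eqxx ?orbT.
  have uH : u \in hubs e u v by have := geo_hubs uv (leq0n _).
  have vH : v \in hubs e u v by have := geo_hubs uv (leqnn _); rewrite geo_dist.
  have [euv|nuv] := eqVneq u v; first by exists u; split; rewrite // euv.
  have [|/pred0Pn[w /andP[/= wh wH]]] := boolP [disjoint high & H (u, v)]; last first.
    by exists w; split=> //; rewrite 4!in_setU wh.
  move=> dis.
  have [|/pred0Pn[w /andP[/= wh wH]]] := boolP [disjoint X & H (u, v)]; last first.
    by exists w; split=> //; rewrite 4!in_setU wh ?orbT.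
  move=> disX.
  have [vR|] := boolP ((u, v) \in R1 :|: R2).
    by exists v; split=> //; rewrite 2!in_setU [v \in [set w | _]]inE vR orbT.
  rewrite in_setU negb_or => /andP[nR1 nR2].
  have sm : (u, v) \in small.
    rewrite inE /= uv ltnNge; apply: contra nR1 => hl.
    by rewrite inE disX andbT inE.
  have np : nice f (u, v) by rewrite /nice nuv sm dis andbT; rewrite inE sm in nR2.
  have FS w x y : x \in F w -> x \notin high -> y \in N x -> y \in S w.
    move=> xF xh yN; rewrite in_setU; apply/orP; right.
    by apply/bigcupP; exists x; rewrite // inE xh.
  have low i : i <= dist e u v -> geo e u v i \notin high.
    move=> le_i; apply/negP=> gh; move/pred0P: dis => /(_ (geo e u v i)).
    by rewrite /= gh geo_hubs.
  have FN w i : i <= dist e u v -> geo e u v i \in F w -> geo e u v i \in S w.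
    by move=> le_i gF; apply: (FS w _ _ gF (low i le_i)); rewrite !inE eqxx.
  have [vF|vF] := boolP (v \in F u).
    by exists v; split=> //; have := FN u _ (leqnn _); rewrite geo_dist //; apply.
  (* The first geodesic vertex missing from [F u] lies in [F v]. It is [u] itself, or its
     predecessor lies in [F u] and brings it into [S u] as a neighbour. *)
  have ex : exists i, (i <= dist e u v) && (geo e u v i \notin F u).
    by exists (dist e u v); rewrite leqnn geo_dist.
  case: (ex_minnP ex) => i /andP[le_i gi] mini.
  have gv : geo e u v i \in F v.
    by have := FP (u, v) i np le_i; rewrite /= (negPf gi).
  exists (geo e u v i); split; [|exact: FN|exact: geo_hubs].
  case: i le_i gi mini {gv} => [|i] le_i gi mini; first by rewrite geo0.
  have gF : geo e u v i \in F u.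
    apply: contraT => ng; have := mini i; rewrite ng ltnW // ltnn.
    by move/(_ isT).
  by apply: (FS u _ _ gF (low i (ltnW le_i))); rewrite !inE geo_edge ?orbT.
- have sR : \sum_v #|[set w | (v, w) \in R1 :|: R2]| <= #|R1| + #|R2|.
    apply: leq_trans (leq_card_setU R1 R2).
    rewrite -[X in _ <= X]sum1_card.
    rewrite (eq_bigl (fun p : T * T => xpredT p.1 && ((p.1, p.2) \in R1 :|: R2))); last by case.
    rewrite -(pair_big_dep xpredT (fun x y => (x, y) \in R1 :|: R2) (fun _ _ => 1)) /=.
    by apply: leq_sum => v _; rewrite -sum1_card; apply/eq_leq/eq_bigl => w; rewrite inE.
  have sN v : #|\bigcup_(x in F v :\: high) N x| <= D * #|F v|.
    apply: leq_trans (card_bigcup_le _ _) _.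
    apply: leq_trans (_ : \sum_(x in F v :\: high) D <= _).
      (* Outside [high] the degree is strictly below [D], leaving room for [x] itself. *)
      apply: leq_sum => x; rewrite !inE -ltnNge => /andP[lt_x _].
      by rewrite (leq_trans (leq_card_setU _ _)) // cards1.
    by rewrite sum_nat_const mulnC leq_mul2l subset_leq_card ?orbT ?subsetDl.
  apply: leq_trans (_ : \sum_v ((#|high| + k * s + 1) +
      (#|[set w | (v, w) \in R1 :|: R2]| + D * #|F v|)) <= _).
    apply: leq_sum => v _; rewrite !addnA.
    apply: leq_trans (leq_card_setU _ _) _; apply: leq_add (sN v).
    apply: leq_trans (leq_card_setU _ _) _; rewrite leq_add2r.
    apply: leq_trans (leq_card_setU _ _) _; rewrite cards1 leq_add2r.
    by apply: leq_trans (leq_card_setU _ _) _; rewrite leq_add2l.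
  rewrite big_split sum_nat_const big_split /= -!addnA leq_add2l addnA.
  by apply: leq_add; rewrite // -big_distrr leq_mul2l cF orbT.
- apply: leq_trans (sum_deg_le simple_e).
  rewrite mulnC -sum_nat_const big_mkcond; apply: leq_sum => x _.
  by case: ifP => //; rewrite inE.
- by apply: leq_trans hX _; rewrite leq_mul2l cpairs orbT.
- by apply: leq_trans hf _; rewrite leq_mul2r cpairs orbT.
Qed.
End Construction.

(** * Choice of the parameters *)

Lemma hub_labeling_size (T : finType) (e : rel T) (m t : nat) :
  simple_graph e -> 0 < t -> 0 < m ->
  (forall e' : rel T, RS_graph e' -> #|edges e'| <= m) ->
  t ^ 21 * m <= #|T| ^ 2 ->
  exists S : T -> {set T}, hub_labeling e S /\
    t ^ 3 * \sum_v #|S v| <= 2 * (#|T| * #|edges e|) + 17 * #|T| ^ 2.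
Proof.
move=> se t0 m0 hm tm; set n := #|T| in tm *.
(* This pays for rounding [n / t ^ 3] up and for each vertex being its own hub. *)
have t3n : t ^ 3 <= n.
  rewrite leqNgt; apply/negP=> ltn.
  have : n ^ 2 < t ^ 21.
    apply: (@leq_trans ((t ^ 3) ^ 2)); first by rewrite ltn_exp2r.
    by rewrite -expnM leq_pexp2l.
  by rewrite ltnNge (leq_trans _ tm) // leq_pmulr.
have n0 : 0 < n by apply: leq_trans t3n; rewrite expn_gt0 t0.
have t3 : 0 < t ^ 3 by rewrite expn_gt0 t0.
pose s := n %/ t ^ 3 + 1.
have sle : t ^ 3 * s <= 2 * n.
  by have := leq_divM n (t ^ 3); rewrite /s mulnDr mulnC; lia.
have sge : n <= t ^ 3 * s.
  by have := ltn_ceil n t3; rewrite /s addn1 mulnC => /ltnW.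
(* As [s * l >= n * t], three rounds miss at most [n ^ 2 / t ^ 3] pairs; clashes affect a fraction
   [l / q = 1 / t ^ 3]; and [D * q * l ^ 2 = t ^ 18], which the remaining factor [t ^ 3] raises to
   [t ^ 21]. *)
have [||S [h [r1 [r2 [hS cS ch c1 c2]]]]] :=
  @exists_hub_labeling T e (t ^ 4) (t ^ 7) (t ^ 3) s 3 m se _ _ hm.
- by rewrite expn_gt0 t0.
- by rewrite expn_gt0 t0.
exists S; split=> //; rewrite -/n in cS c1 c2.
have {}c1 : t ^ 3 * r1 <= n ^ 2.
  rewrite -(@leq_pmul2l (n ^ 3)) ?expn_gt0 ?n0 //.
  apply: leq_trans c1; rewrite mulnA leq_mul2r -expnMn leq_exp2r //.
  by rewrite (expnSr t 3) mulnA (mulnC s) leq_mul2r sge !orbT.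
have {}c2 : t ^ 3 * r2 <= n ^ 2.
  rewrite -(@leq_pmul2l (t ^ 4)) ?expn_gt0 ?t0 //.
  by rewrite mulnA -expnD [X in _ <= X]mulnC.
have {}ch : n * (t ^ 3 * h) <= n * (2 * #|edges e|) by rewrite leq_mul2l ch orbT.
apply: leq_trans (_ : t ^ 3 * (n * (h + 3 * s + 1) + r1 + r2 +
  t ^ 3 * (t ^ 7 * (t ^ 4 * t ^ 4) * (8 * m))) <= _); first by rewrite leq_mul2l cS orbT.
(* After the edge term, the summands contribute 6 + 1 + 1 + 1 + 8 = 17 times [n ^ 2]. *)
have -> : t ^ 3 * (n * (h + 3 * s + 1) + r1 + r2 +
  t ^ 3 * (t ^ 7 * (t ^ 4 * t ^ 4) * (8 * m))) =
  n * (t ^ 3 * h) + 3 * (n * (t ^ 3 * s)) + n * t ^ 3 + t ^ 3 * r1 + t ^ 3 * r2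
  + 8 * (t ^ 21 * m).
  have -> : t ^ 21 = t ^ 3 * (t ^ 3 * (t ^ 7 * (t ^ 4 * t ^ 4))) by rewrite -!expnD.
  by lia.
have : n * (t ^ 3 * s) <= 2 * n ^ 2 by rewrite -mulnn [X in _ <= X]mulnCA leq_mul2l sle orbT.
have : n * t ^ 3 <= n ^ 2 by rewrite -mulnn leq_mul2l t3n orbT.
lia.
Qed.

(** * Roots of [RS] and the conclusion *)

Lemma card_edges_le (T : finType) (e : rel T) : #|edges e| <= #|T| ^ 2.
Proof.
apply: (@leq_trans #|[set [set p.1; p.2] | p in [set: T * T]]|).
  apply: subset_leq_card; apply/subsetP=> s /imset2P[x y _ _ ->].
  by apply/imsetP; exists (x, y).
by apply: leq_trans (leq_imset_card _ _) _; rewrite cardsT card_prod mulnn.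
Qed.

(** [maxRS] ranges over finite functions, so [e] is tabulated; the table agrees with [e] only
    pointwise, and the properties are carried over by hand. *)
Lemma RS_graph_le_maxRS n (e : rel 'I_n) : RS_graph e -> #|edges e| <= maxRS n.
Proof.
move=> rs; pose f : {ffun 'I_n -> {ffun 'I_n -> bool}} := [ffun x => [ffun y => e x y]].
have ef : (fun x y => f x y) =2 e by move=> x y; rewrite !ffunE.
have eqE : edges (fun x y => f x y) = edges e.
  by apply/setP=> s; apply/imset2P/imset2P=> -[x y xT exy ->]; exists x y => //;
    by move: exy; rewrite !inE /= !ffunE.
rewrite -eqE.
apply: (@leq_bigmax_cond _
   (fun f : {ffun 'I_n -> {ffun 'I_n -> bool}} => RS_graph (fun x y => f x y))
   (fun f => #|edges (fun x y => f x y)|) f).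
rewrite /RS_graph /simple_graph in rs *; rewrite /induced_matching eqE.
case/andP: rs => /andP[/forallP irr /forallP sym] ->; rewrite andbT.
apply/andP; split; apply/forallP=> x; first by rewrite ef irr.
by apply/forallP=> y; rewrite !ef (forallP (sym x)).
Qed.

Lemma INR_expn a k : INR (a ^ k) = (INR a ^ k)%R.
Proof. by elim: k => // k IH; rewrite expnS mult_INR IH. Qed.

Lemma RS_root n : 0 < n -> exists t, [/\ 0 < t, t ^ 21 * maxn 1 (maxRS n) <= n ^ 2 &
  (0 < Rpower (RS n) (/ 7) <= 8 * INR (t ^ 3))%R].
Proof.
move=> n0; set m := maxn 1 (maxRS n).
have m0 : 0 < m by rewrite leq_max.
have mn : m <= n ^ 2.
  rewrite geq_max expn_gt0 n0 /=; apply/bigmax_leqP=> f _.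
  by rewrite -[X in _ <= X ^ 2](card_ord n) card_edges_le.
have P1 : exists t, t ^ 21 * m <= n ^ 2 by exists 1; rewrite exp1n mul1n.
have Pub t : t ^ 21 * m <= n ^ 2 -> t <= n ^ 2.
  move=> ht; apply: leq_trans ht; apply: leq_trans (leq_pmulr _ m0).
  by case: t => // t; rewrite -{1}(expn1 t.+1) leq_pexp2l.
case: (ex_maxnP P1 Pub) => t tm tmax.
have t0 : 0 < t by apply: tmax; rewrite exp1n mul1n.
exists t; split=> //.
have mR : (0 < INR m)%R by apply: lt_0_INR; apply/ltP.
have pR : (0 < INR (n * n))%R by apply: lt_0_INR; apply/ltP; rewrite muln_gt0 n0.
have RS0 : (0 < RS n)%R by apply: Rdiv_lt_0_compat.
have TR : (0 < INR (2 * t))%R by apply: lt_0_INR; apply/ltP; rewrite muln_gt0.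
(* Maximality of [t] gives [RS n < (t + 1) ^ 21], and [t + 1 <= 2 * t]. The seventh root of the
   bound is [8 * t ^ 3]. *)
have RSle : (RS n <= INR (2 * t) ^ 21)%R.
  apply: (Rmult_le_reg_r (INR m)) => //.
  rewrite /RS /Rdiv Rmult_assoc Rinv_l ?Rmult_1_r; last by apply: Rgt_not_eq.
  rewrite -INR_expn -mult_INR; apply/le_INR/leP.
  rewrite mulnn leqNgt; apply/negP=> lt_n.
  have /tmax : t.+1 ^ 21 * m <= n ^ 2.
    apply: leq_trans (ltnW lt_n); rewrite leq_mul2r; apply/orP; right.
    by rewrite leq_exp2r //; lia.
  by rewrite ltnn.
split; first by apply: exp_pos.
apply: Rle_trans (_ : (INR (2 * t) ^ 3 <= _)%R); last first.
  rewrite -INR_expn (_ : 8%R = INR 8); last by rewrite /=; lra.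
  rewrite -mult_INR; apply/le_INR/leP.
  by rewrite expnMn.
have -> : (INR (2 * t) ^ 3 = Rpower (INR (2 * t) ^ 21) (/ 7))%R.
  rewrite -!Rpower_pow // Rpower_mult; congr Rpower; rewrite /=; lra.
by apply: Rle_Rpower_l; [lra | split].
Qed.

Theorem theorem2 :
  exists c : R, (0 < c <= 7)%R /\
  forall K : R, (0 < K)%R ->
  exists CK : R,
  forall (n : nat) (e : rel 'I_n),
    simple_graph e ->
    (INR #|edges e| <= K * INR n)%R ->
    exists S : 'I_n -> {set 'I_n},
      hub_labeling e S /\
      (/ INR n * INR (\sum_(v : 'I_n) #|S v|)
         <= CK * (INR n / Rpower (RS n) (/ c)))%R.
Proof.
exists 7%R; split; first by lra.
(* The factor [2 * K + 17] comes from the labeling with at most [K * n] edges, the 8 from replacing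
   [t ^ 3] by the seventh root of [RS n]. *)
move=> K K0; exists (8 * (2 * K + 17))%R => -[|n] e se he.
  exists (fun=> set0); split; first by move=> [].
  by rewrite big_ord0 /= /Rdiv Rmult_0_l !Rmult_0_r; apply: Rle_refl.
have [t [t0 tm [p0 pt]]] := RS_root (ltn0Sn n).
have RS_le (e' : rel 'I_n.+1) : RS_graph e' -> #|edges e'| <= maxn 1 (maxRS n.+1).
  by move=> /RS_graph_le_maxRS le; rewrite leq_max le orbT.
have [||S [hS cS]] := hub_labeling_size se t0 _ RS_le; first by rewrite leq_max.
  by rewrite card_ord.
exists S; split=> //; rewrite card_ord in cS.
set sz := \sum_(v : _) _ in cS *; set N := INR n.+1 in he *.
have N0 : (0 < N)%R by apply: lt_0_INR; apply/ltP.
have T0 : (0 < INR (t ^ 3))%R by apply: lt_0_INR; apply/ltP; rewrite expn_gt0 t0.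
have sz_le : (INR (t ^ 3) * INR sz <= (2 * K + 17) * (N * N))%R.
  move: cS; rewrite -mulnn; move: (t ^ 3) => d /leP/le_INR.
  rewrite !(mult_INR, plus_INR) -/N.
  rewrite (_ : INR 2 = 2%R) // (_ : INR 17 = 17%R); last by rewrite /=; lra.
  have := Rmult_le_compat_l N _ _ (Rlt_le _ _ N0) he.
  by rewrite /=; lra.
set P := Rpower _ _ in p0 pt *.
have sz0 : (0 <= INR sz)%R by apply: pos_INR.
apply: (Rmult_le_reg_r (N * P)); first by apply: Rmult_lt_0_compat.
rewrite (_ : / N * INR sz * (N * P) = P * INR sz)%R; last by field; lra.
rewrite (_ : 8 * (2 * K + 17) * (N / P) * (N * P) =
  8 * ((2 * K + 17) * (N * N)))%R; last by field; lra.
apply: Rle_trans (_ : (8 * INR (t ^ 3) * INR sz <= _)%R); last by lra.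
exact: Rmult_le_compat_r.
Qed.
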